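(* Let $E_{\mathrm{limit}}>0$ and consider the received video quality maximization problem $$D_{\mathrm q}^\star=\max_{D,\mathbf t,\mathbf p}\ D$$ over a real number $D$ and real families $\mathbf t=(t_i(\mathbf X,\mathbf H))$ and $\mathbf p=(p_i(\mathbf X,\mathbf H))$ with $p_i(\mathbf X,\mathbf H)\ge 0$, indexed by $\mathbf X\in\mathcal X^K$, $\mathbf H\in\mathcal H^K$, $i\in\mathcal I(\mathbf X)$, subject to, for all $\mathbf X\in\mathcal X^K$ and $\mathbf H=(H_k)_{k\in\mathcal K}\in\mathcal H^K$: $$t_i(\mathbf X,\mathbf H)\ge 0\ \ (i\in\mathcal I(\mathbf X)),\qquad \sum_{i\in\mathcal I(\mathbf X)}t_i(\mathbf X,\mathbf H)\le T,$$ $$t_i(\mathbf X,\mathbf H)\,B\log_2\!\left(1+\frac{p_i(\mathbf X,\mathbf H)H_k}{n_0}\right)\ge S_i(\mathbf X)DT\quad (k\in\mathcal K_i(\mathbf X),\ i\in\mathcal I(\mathbf X)),$$ $$\sum_{i\in\mathcal I(\mathbf X)}t_i(\mathbf X,\mathbf H)\,p_i(\mathbf X,\mathbf H)\le E_{\mathrm{limit}}.$$ Then an optimal solution $(D_{\mathrm q}^\star,\mathbf t_{\mathrm q}^\star,\mathbf p_{\mathrm q}^\star)$ of this problem is given by $$D_{\mathrm q}^\star=\frac{B\ln\!\left(\frac{E_{\mathrm{limit}}\min\mathcal H}{n_0T}+1\right)}{\ln 2\ \max_{\mathbf X\in\mathcal X^K}\sum_{i\in\mathcal I(\mathbf X)}S_i(\mathbf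 X)}$$ and, for all $\mathbf X\in\mathcal X^K$, $\mathbf H\in\mathcal H^K$, $i\in\mathcal I(\mathbf X)$, $$t_{\mathrm q,i}^\star(\mathbf X,\mathbf H)=\frac{S_i(\mathbf X)D_{\mathrm q}^\star T\ln 2}{B\left(W\!\left(\frac{\lambda^\star(\mathbf X,\mathbf H)H_{i,\min}(\mathbf X,\mathbf H)}{n_0e}-\frac1e\right)+1\right)},$$ $$p_{\mathrm q,i}^\star(\mathbf X,\mathbf H)=\frac{n_0\left(e^{W\left(\frac{\lambda^\star(\mathbf X,\mathbf H)H_{i,\min}(\mathbf X,\mathbf H)}{n_0e}-\frac1e\right)+1}-1\right)}{H_{i,\min}(\mathbf X,\mathbf H)},$$ where, for each $(\mathbf X,\mathbf H)\in\mathcal X^K\times\mathcal H^K$, $\lambda^\star(\mathbf X,\mathbf H)>0$ is the real number satisfying $$\sum_{i\in\mathcal I(\mathbf X)}\frac{S_i(\mathbf X)D_{\mathrm q}^\star\ln 2}{B\left(W\!\left(\frac{\lambda^\star(\mathbf X,\mathbf H)H_{i,\min}(\mathbf X,\mathbf H)}{n_0e}-\frac1e\right)+1\right)}=1 .$$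
   Context: There are $K\ge 1$ users, $\mathcal K=\{1,\ldots,K\}$. $\mathcal X=\{(n_h,n_v): n_h=1,\ldots,N_h,\ n_v=1,\ldots,N_v\}$ is the finite set of viewing directions; $\mathbf X=(\mathbf X_k)_{k\in\mathcal K}\in\mathcal X^K$ is the viewing direction state. $\mathcal H$ is a finite nonempty set of positive reals (possible channel powers) and $\mathbf H=(H_k)_{k\in\mathcal K}\in\mathcal H^K$ is the channel state. For each $\mathbf X$ and $k$, $\Phi_k(\mathbf X)$ is the finite nonempty set of tiles that must be transmitted to user $k$, and $\Phi(\mathbf X)=\bigcup_{k\in\mathcal K}\Phi_k(\mathbf X)$. $\Phi(\mathbf X)$ is partitioned into $I(\mathbf X)$ disjoint nonempty sets $\mathcal S_i(\mathbf X)$, $i\in\mathcal I(\mathbf X)=\{1,\ldots,I(\mathbf X)\}$, different sets being needed by different groups of users: $\mathcal K_i(\mathbf X)\subseteq\mathcal K$ (nonempty) is the set of users that need the tiles in $\mathcal S_i(\mathbf X)$, and $S_i(\mathbf X)\ge 1$ is the number of tiles in $\mathcal S_i(\mathbf X)$. $B>0$ is the bandwidth, $T>0$ the frame duration, $n_0>0$ the noise power, $E_{\mathrm{limit}}$ the transmission energy budget, and $D$ the encoding rate of each tile (here a real optimization variable). $t_i(\mathbf X,\mathbf H)$ and $p_i(\mathbf X,\mathbf H)$ are the transmission time and power for the tiles in $\mathcal S_i(\mathbf X)$. $H_{i,\min}(\mathbf X,\mathbf H)=\min_{k\in\mathcal K_i(\mathbf X)}H_k$. $W(\cdot)$ is the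 Lambert function, i.e. the principal branch: for $z\ge -1/e$, $W(z)\ge -1$ and $W(z)e^{W(z)}=z$. $e$ is the base of the natural logarithm. *)

(* Defs.v *)
From HB Require Import structures.
From mathcomp Require Import all_boot all_order all_algebra finmap.
From mathcomp Require boolp classical_sets.
From mathcomp Require Import reals sequences exp.

Set Implicit Arguments.
Unset Strict Implicit.
Unset Printing Implicit Defensive.

Import Order.TTheory GRing.Theory Num.Theory.
Local Open Scope ring_scope.

(* Principal branch of the Lambert function: for z >= - e^-1, the unique
   w >= -1 such that w * e^w = z (and the junk value 0 for z < - e^-1). *)
Definition lambertW (R : realType) (z : R) : R :=
  classical_sets.xget 0 (fun w : R => -1 <= w /\ w * expR w = z).

Definition log2 (R : realType) (x : R) : R := ln x / ln 2.

(* Minimum of a nonempty sequence (0 on the empty one). *)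
Definition seq_min (R : realType) (s : seq R) : R :=
  \big[Num.min/head 0 s]_(x <- s) x.

(* The direction (n_h, n_v) with 1 <= n_h <= N_h and 1 <= n_v <= N_v is encoded
   by the pair of ordinals (n_h - 1, n_v - 1). *)
Definition view_state (K Nh Nv : nat) : finType :=
  {ffun 'I_K -> 'I_Nh * 'I_Nv}.

(* In viewing direction state X, the tiles to be transmitted are partitioned
   according to the exact set of users that need them: the users needing a tile
   of [group_tiles i], where [i : 'I_(ngroups X)], are those of
   [group_users i]. *)
Record system (R : realType) := System {
  nusers : nat;
  nhoriz : nat;
  nvert : nat;
  tile : finType;
  needed : view_state nusers nhoriz nvert -> 'I_nusers -> {set tile};
  ngroups : view_state nusers nhoriz nvert -> nat;
  group_tiles :
    forall X : view_state nusers nhoriz nvert, 'I_(ngroups X) -> {set tile};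
  group_users :
    forall X : view_state nusers nhoriz nvert, 'I_(ngroups X) -> {set 'I_nusers};
  powers : {fset R};
  bandwidth : R;
  duration : R;
  noise : R;
  nusers_gt0 : (0 < nusers)%N;
  nhoriz_gt0 : (0 < nhoriz)%N;
  nvert_gt0 : (0 < nvert)%N;
  needed_neq0 : forall X k, needed X k != finset.set0;
  group_tiles_neq0 :
    forall X (i : 'I_(ngroups X)), group_tiles i != finset.set0;
  group_tiles_disjoint :
    forall X (i j : 'I_(ngroups X)),
      i != j -> [disjoint group_tiles i & group_tiles j];
  group_tiles_cover :
    forall X, (\bigcup_(i < ngroups X) group_tiles i = \bigcup_k needed X k)%SET;
  group_users_neq0 :
    forall X (i : 'I_(ngroups X)), group_users i != finset.set0;
  group_usersE :
    forall X (i : 'I_(ngroups X)) x k,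
      x \in group_tiles i -> (k \in group_users i) = (x \in needed X k);
  group_users_inj : forall X, injective (@group_users X);
  powers_neq0 : (0 < #|` powers|)%N;
  powers_gt0 : forall h, h \in powers -> 0 < h;
  bandwidth_gt0 : 0 < bandwidth;
  duration_gt0 : 0 < duration;
  noise_gt0 : 0 < noise
}.

Section Problem.
Context (R : realType) (s : system R).

Definition views : finType := view_state (nusers s) (nhoriz s) (nvert s).

Definition channels : finType := {ffun 'I_(nusers s) -> powers s}.

Definition gain (H : channels) (k : 'I_(nusers s)) : R := val (H k).

Definition ntiles (X : views) (i : 'I_(ngroups X)) : nat := #|group_tiles i|.

Definition gain_min (X : views) (H : channels) (i : 'I_(ngroups X)) : R :=
  seq_min [seq gain H k | k in group_users i].

Definition group_family := forall X : views, channels -> 'I_(ngroups X) -> R.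

Definition feasible (E D : R) (t p : group_family) : Prop :=
  forall (X : views) (H : channels),
    [/\ forall i, 0 <= p X H i,
        forall i, 0 <= t X H i,
        \sum_i t X H i <= duration s,
        forall i k, k \in group_users i ->
          (ntiles i)%:R * D * duration s <=
          t X H i * bandwidth s * log2 (1 + p X H i * gain H k / noise s)
      & \sum_i t X H i * p X H i <= E].

Definition optimal (E D : R) (t p : group_family) : Prop :=
  feasible E D t p /\
  forall D' t' p', feasible E D' t' p' -> D' <= D.

Definition quality_star (E : R) : R :=
  bandwidth s * ln (E * seq_min (powers s) / (noise s * duration s) + 1) /
  (ln 2 * (\max_(X : views) \sum_i @ntiles X i)%N%:R).

Definition lambert_term (lam : R) (X : views) (H : channels)
    (i : 'I_(ngroups X)) : R :=
  lambertW (lam * gain_min H i / (noise s * expR 1) - 1 / expR 1) + 1.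

Definition is_multiplier (D : R) (X : views) (H : channels) (lam : R) : Prop :=
  0 < lam /\
  \sum_(i < ngroups X)
    (ntiles i)%:R * D * ln 2 / (bandwidth s * lambert_term lam H i) = 1.

Definition time_star (D : R) (lam : views -> channels -> R) : group_family :=
  fun X H i =>
    (ntiles i)%:R * D * duration s * ln 2 /
    (bandwidth s * lambert_term (lam X H) H i).

Definition power_star (lam : views -> channels -> R) : group_family :=
  fun X H i =>
    noise s * (expR (lambert_term (lam X H) H i) - 1) / gain_min H i.

End Problem.

(* Main.v *)
(* Write u = W(lambda h / (n0 e) - 1/e) + 1, so that 1 + (u - 1) e^u =
   lambda h / n0. Then u is a continuous increasing function of lambda, onto
   the positive reals, and the time constraint determines lambda. Sending a
   nats in time t at channel power h costs the energy t n0 (e^(a/t) - 1) / h,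
   a convex function of t with slope -lambda at t = a/u: hence the proposed
   times minimize the energy among all allocations of the frame, and they do
   at least as well as using the same rate for every group, which meets the
   budget by the choice of D. Conversely, in the state with the most tiles and
   the worst channel, concavity of the logarithm bounds the total rate within
   the energy budget. *)
Require Import Defs.
From mathcomp Require Import all_boot all_order all_algebra finmap.
From mathcomp Require Import reals sequences exp.
From mathcomp Require Import boolp classical_sets functions.
From mathcomp Require Import topology normedtype realfun.
From mathcomp Require Import ring lra.
Set Implicit Arguments.
Unset Strict Implicit.

Import Order.TTheory GRing.Theory Num.Theory.
Import numFieldNormedType.Exports.
Local Open Scope ring_scope.

(** * Inversion, monotonicity and continuity of the Lambert function *)

Section LambertW.
Context {R : realType}.
Implicit Types u v w x z : R.

Lemma expR_tangent u v : u != v -> expR u * (1 + (v - u)) < expR v.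
Proof.
move=> neq_uv; have vE : expR v = expR u * expR (v - u).
  by rewrite -expRD addrCA subrr addr0.
by rewrite vE ltr_pM2l ?expR_gt0// expR_gt1Dx// subr_eq0 eq_sym.
Qed.

Lemma expR_tangent_le u v : expR u * (1 + (v - u)) <= expR v.
Proof.
by have [->|/expR_tangent/ltW//] := eqVneq u v; rewrite subrr addr0 mulr1.
Qed.

(** The tangent of exp at [v], evaluated at [w], gives [v * expR v - w * expR w > (1 + w) * (expR v
    - expR w)], and both factors on the right are nonnegative. *)
Lemma mul_expR_lt v w : -1 <= w -> w < v -> w * expR w < v * expR v.
Proof.
move=> w_ge lt_wv; have := @expR_tangent v w; rewrite gt_eqF// => /(_ isT) tan.
have: 0 <= (1 + w) * (expR v - expR w).
  by rewrite mulr_ge0 ?subr_ge0 ?ler_expR ?(ltW lt_wv)//; lra.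
by lra.
Qed.

Lemma mul_expR_inj v w : -1 <= v -> -1 <= w ->
  v * expR v = w * expR w -> v = w.
Proof.
move=> v_ge w_ge eq_vw; have [lt_vw|lt_wv|//] := ltgtP v w.
  by have := mul_expR_lt v_ge lt_vw; rewrite eq_vw ltxx.
by have := mul_expR_lt w_ge lt_wv; rewrite eq_vw ltxx.
Qed.

Lemma lambertWK w : -1 <= w -> lambertW (w * expR w) = w.
Proof.
move=> w_ge; apply: xget_unique => //= v [v_ge /mul_expR_inj]; exact.
Qed.

Lemma mul_expR_continuous : continuous (fun w => w * expR w).
Proof. by move=> w; apply: cvgM; [exact: cvg_id|exact: continuous_expR]. Qed.

Lemma lambertWP z : - (expR 1)^-1 <= z ->
  -1 <= lambertW z /\ lambertW z * expR (lambertW z) = z.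
Proof.
move=> z_ge; apply: (@xgetPex _ 0 (fun w => -1 <= w /\ w * expR w = z)).
(* A preimage is sought in [[-1, z + 1]]: as [z + 1 >= 0], the value at the right end is at least
   [z + 1], hence above [z]. *)
have z1_ge : 0 <= z + 1.
  have : (expR 1)^-1 <= 1 :> R.
    by rewrite invf_le1 ?expR_gt0//; have := expR_ge1Dx (1 : R); lra.
  by lra.
have z1_geN1 : -1 <= z + 1 by lra.
have := @IVT R (fun w => w * expR w) (-1) (z + 1) z z1_geN1.
case.
- exact/continuous_subspaceT/mul_expR_continuous.
- rewrite ge_min le_max expRN mulN1r z_ge/=; apply/orP; right.
  by have := expR_ge1Dx (z + 1) => ?; nra.
- by move=> w; rewrite in_itv/= => /andP[w_ge _] wz; exists w.
Qed.

Lemma lambertW_lt x z : - (expR 1)^-1 <= x -> x < z -> lambertW x < lambertW z.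
Proof.
move=> x_ge lt_xz; have [Wx_ge xE] := lambertWP x_ge.
have [Wz_ge zE] := lambertWP (le_trans x_ge (ltW lt_xz)).
rewrite ltNge le_eqVlt; apply/negP => /orP[/eqP eqW|/(mul_expR_lt Wz_ge)].
  by move: lt_xz; rewrite -xE -zE eqW ltxx.
by rewrite xE zE ltNge (ltW lt_xz).
Qed.

(** The inverse of a continuous injection on a segment is continuous on the image. The bound is
    strict because the junk value 0 to the left of -1/e breaks continuity there. *)
Lemma lambertW_continuous z : - (expR 1)^-1 < z ->
  {for z, continuous (@lambertW R)}.
Proof.
move=> z_gt; have [W_ge WE] := lambertWP (ltW z_gt).
(* Any [b] above [lambertW z] makes [z] interior to the image of [[-1, b]]. *)
pose b := lambertW z + 1; have b_ge : -1 <= b by rewrite /b; lra.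
have lt_zb : z < b * expR b by rewrite -WE mul_expR_lt// /b; lra.
have Wcont : {within `[(-1 * expR (-1) : R), (b * expR b : R)],
    continuous (@lambertW R)}%classic.
  apply: (@segment_can_le_continuous R (-1) b (fun w => w * expR w)) => //.
    exact/continuous_subspaceT/mul_expR_continuous.
  by move=> w; rewrite in_itv/= => /andP[w_ge _]; rewrite lambertWK.
rewrite expRN mulN1r in Wcont.
have [Wc _ _] := (continuous_within_itvP _ (lt_trans z_gt lt_zb)).1 Wcont.
by apply: Wc; rewrite in_itv/= z_gt.
Qed.

End LambertW.

(** * The rate as a function of the multiplier, and convexity inequalities *)

Section Rate.
Context {R : realType}.
Implicit Types (c l m t u x y : R).

(* The spectral efficiency, in nats, at normalized multiplier [x]: the inverse
   of [u |-> 1 + (u - 1) * expR u] on nonnegative reals. *)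
Definition rate x := lambertW (x / expR 1 - 1 / expR 1) + 1.

Lemma rate_arg_ge x : 0 <= x -> - (expR 1)^-1 <= x / expR 1 - 1 / expR 1.
Proof.
by move=> x_ge; rewrite mul1r lerBrDr addNr divr_ge0 ?expR_ge0.
Qed.

(** With [w = rate x - 1], the equation [w * expR w = (x - 1) / e] is multiplied by e. *)
Lemma rateE x : 0 <= x -> 1 + (rate x - 1) * expR (rate x) = x.
Proof.
move=> /rate_arg_ge/lambertWP[_ WE].
rewrite /rate addrK expRD mulrA WE mulrBl !divfK ?expR_eq0//.
by rewrite addrC subrK.
Qed.

Lemma rateK u : 0 <= u -> rate (1 + (u - 1) * expR u) = u.
Proof.
move=> u_ge; rewrite /rate -mulrBl [1 + _ - 1]addrC addKr -mulrA -expRN -expRD.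
by rewrite lambertWK ?subrK// lerBrDr addNr.
Qed.

Lemma rate_lt x y : 0 <= x -> x < y -> rate x < rate y.
Proof.
move=> x_ge lt_xy; rewrite ltrD2r lambertW_lt ?rate_arg_ge//.
by rewrite ltrD2r ltr_pM2r// invr_gt0 expR_gt0.
Qed.

Lemma rate_le x y : 0 <= x -> x <= y -> rate x <= rate y.
Proof.
by move=> x_ge; rewrite le_eqVlt => /predU1P[->//|/(rate_lt x_ge)/ltW].
Qed.

Lemma rate_gt0 x : 0 < x -> 0 < rate x.
Proof.
move=> /(rate_lt (lexx 0)); apply: le_lt_trans.
have /lambertWP[+ _] := rate_arg_ge (lexx 0).
by rewrite /rate; lra.
Qed.

Lemma rate_continuous x : 0 < x -> {for x, continuous rate}.
Proof.
move=> x_gt; apply: cvgD; last exact: cvg_cst.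
apply: (@continuous_comp _ _ _
  (fun x => x / expR 1 - 1 / expR 1) (@lambertW R)).
  apply: cvgB; last exact: cvg_cst.
  by apply: cvgM; [exact: cvg_id|exact: cvg_cst].
apply: lambertW_continuous.
by rewrite mul1r ltrBrDr addNr divr_gt0 ?expR_gt0.
Qed.

(** * Existence and uniqueness of the multiplier *)

Section Multiplier.
Variables (I : finType) (c g : I -> R).
Hypotheses (c_gt0 : forall i, 0 < c i) (g_gt0 : forall i, 0 < g i).

Let load l := \sum_i c i / rate (l * g i).

Let load_decreasing l m (i0 : I) : 0 < l -> l < m -> load m < load l.
Proof.
move=> l_gt lt_lm; apply: ltr_sum => [|i _].
  by apply/hasP; exists i0; rewrite ?mem_index_enum.
have lg_gt : 0 < l * g i by rewrite mulr_gt0.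
have lt_lg : l * g i < m * g i by rewrite ltr_pM2r.
rewrite ltr_pM2l// ltf_pV2 ?posrE ?rate_gt0//; last exact: lt_trans lt_lg.
by rewrite rate_lt// ltW.
Qed.

Let load_continuous l : 0 < l -> {for l, continuous load}.
Proof.
move=> l_gt; apply: cvg_big => [|i _]; first exact: add_continuous.
apply: cvgM; first exact: cvg_cst.
have lg_gt : 0 < l * g i by rewrite mulr_gt0.
have rc : {for l, continuous (fun l : R => rate (l * g i))}.
  apply: (@continuous_comp _ _ _ (fun l => l * g i) rate).
    by apply: cvgM; [exact: cvg_id|exact: cvg_cst].
  exact: rate_continuous.
by apply: cvgV; [rewrite gt_eqF ?rate_gt0|exact: rc].
Qed.

Lemma rate_multiplier_unique (i0 : I) :
  exists! l, 0 < l /\ \sum_i c i / rate (l * g i) = 1.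
Proof.
(* [psi] inverts [rate]; its positivity is the tangent of exp at [u] evaluated at 0. *)
pose psi u := 1 + (u - 1) * expR u.
have psi_gt0 u : 0 < u -> 0 < psi u.
  move=> u_gt; have := @expR_tangent R u 0.
  rewrite gt_eqF// expR0 /psi => /(_ isT).
  by lra.
pose C := \sum_i c i.
have c_le i : c i <= C.
  by rewrite /C (bigD1 i)//= lerDl sumr_ge0// => j _; exact/ltW.
have C_gt : 0 < C by exact: lt_le_trans (c_le i0).
(* At [a] the term [i0] alone equals 1. At [b] every rate is at least [C], so the load is at most
   [C / C]; the summand [a] only ensures [a <= b]. *)
pose a := psi (c i0) / g i0; pose b := a + \sum_i psi C / g i.
have a_gt : 0 < a by rewrite divr_gt0 ?psi_gt0.
have term_gt i : 0 < psi C / g i by rewrite divr_gt0 ?psi_gt0.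
have le_ab : a <= b by rewrite lerDl sumr_ge0// => i _; exact/ltW.
have load_a : 1 <= load a.
  rewrite /load (bigD1 i0)//= {1}/a divfK ?gt_eqF// rateK ?(ltW (c_gt0 _))//.
  rewrite divff ?gt_eqF// lerDl sumr_ge0// => i _.
  by rewrite divr_ge0 ?ltW// rate_gt0// mulr_gt0.
have load_b : load b <= 1.
  rewrite -(divff (lt0r_neq0 C_gt)) mulr_suml; apply: ler_sum => i _.
  have le_b : psi C <= b * g i.
    rewrite -ler_pdivrMr// /b (bigD1 i)//= addrCA lerDl.
    by apply: addr_ge0; [exact/ltW|apply: sumr_ge0 => j _; exact/ltW].
  have bg_gt : 0 < b * g i by apply: lt_le_trans le_b; exact: psi_gt0.
  rewrite ler_pM2l// lef_pV2 ?posrE ?rate_gt0//.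
  by rewrite -[leLHS](rateK (ltW C_gt)) rate_le// ltW ?psi_gt0.
have load_cont : {within `[a, b], continuous load}%classic.
  apply: continuous_in_subspaceT => x; rewrite inE/= in_itv/= => /andP[ax _].
  exact/load_continuous/(lt_le_trans a_gt).
have [|l] := IVT le_ab load_cont (v := 1).
  by rewrite ge_min load_b orbT le_max load_a.
rewrite in_itv/= => /andP[al _] load_l.
have l_gt : 0 < l by exact: lt_le_trans al.
exists l; split=> // m [m_gt load_m].
have [lt_lm|lt_ml|//] := ltgtP l m.
  by have := load_decreasing i0 l_gt lt_lm; rewrite load_l /load load_m ltxx.
by have := load_decreasing i0 m_gt lt_ml; rewrite load_l /load load_m ltxx.
Qed.

End Multiplier.

(* Sending [t * u] nats in time [t] costs [t * (expR u - 1)], a convex function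
   of [t] with slope [- (1 + (u - 1) * expR u)]. *)
Lemma energy_tangent t u t' u' : 0 <= t' -> t * u = t' * u' ->
  t * (expR u - 1) - (1 + (u - 1) * expR u) * (t' - t) <= t' * (expR u' - 1).
Proof.
move=> t'_ge eq_tu.
have := ler_wpM2l t'_ge (expR_tangent_le u u').
suff -> : t' * (expR u * (1 + (u' - u))) =
    t * (expR u - 1) - (1 + (u - 1) * expR u) * (t' - t) + t' by lra.
have -> : t' * (expR u * (1 + (u' - u))) =
    expR u * (t' + (t' * u') - t' * u) by ring.
by rewrite -eq_tu; ring.
Qed.

Lemma ln_tangent x y : 0 < x -> 0 < y -> ln y <= ln x + (y - x) / x.
Proof.
move=> x_gt y_gt; have yx_gt : 0 < y / x by rewrite divr_gt0.
have -> : y = x * (y / x) by rewrite mulrC divfK ?gt_eqF.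
rewrite lnM ?posrE// lerD2l -[X in ln X](subrK 1) addrC.
have -> : (x * (y / x) - x) / x = y / x - 1 by field; rewrite gt_eqF.
by rewrite le_ln1Dx// ltrBrDr addNr.
Qed.

(* Each logarithm lies below its tangent at [1 + Y], whose value at [y i = 0] is
   nonnegative: this is why [\sum_i t i <= T] suffices. *)
Lemma sum_ln1D_le (I : finType) (t y : I -> R) (T Y : R) :
  (forall i, 0 <= t i) -> (forall i, 0 <= y i) -> 0 < Y ->
  \sum_i t i <= T -> \sum_i t i * y i <= T * Y ->
  \sum_i t i * ln (1 + y i) <= T * ln (1 + Y).
Proof.
move=> t_ge y_ge Y_gt le_T le_TY; have Y1_gt : 0 < 1 + Y by lra.
have slope_ge : 0 <= ln (1 + Y) - Y / (1 + Y).
  have := ln_tangent Y1_gt ltr01; rewrite ln1.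
  have -> : (1 - (1 + Y)) / (1 + Y) = - (Y / (1 + Y)) by field; rewrite gt_eqF.
  by [].
have term_le i : t i * ln (1 + y i) <=
    t i * (ln (1 + Y) - Y / (1 + Y)) + t i * y i / (1 + Y).
  have y1_gt : 0 < 1 + y i by have := y_ge i; lra.
  apply: le_trans (ler_wpM2l (t_ge i) (ln_tangent Y1_gt y1_gt)) _.
  by rewrite le_eqVlt; apply/orP; left; apply/eqP; field; rewrite gt_eqF.
apply: le_trans (ler_sum _ (fun i _ => term_le i)) _.
rewrite big_split/= -!mulr_suml.
have -> : T * ln (1 + Y) = T * (ln (1 + Y) - Y / (1 + Y)) + T * Y / (1 + Y).
  by rewrite mulrBr mulrA subrK.
by rewrite lerD ?ler_wpM2r// invr_ge0 ltW.
Qed.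

End Rate.

(** The fold starts from the head, so no value foreign to the sequence enters the minimum. *)
Lemma seq_min_mem (R : realType) (r : seq R) :
  (0 < size r)%N -> seq_min r \in r.
Proof.
case: r => // x r _; rewrite /seq_min big_seq_cond /=.
apply: (big_ind (fun y => y \in x :: r)) => [|y z yr zr|y /andP[]//].
  exact: mem_head.
by rewrite /Num.min; case: ifP.
Qed.

Lemma seq_min_le (R : realType) (r : seq R) x : x \in r -> seq_min r <= x.
Proof. by move=> xr; rewrite /seq_min; exact: ge_bigmin_seq. Qed.

(** * Positivity and extremal states of the system *)

Section System.
Context {R : realType} {s : system R}.
Implicit Types (X : views s) (H : channels s).

Lemma gain_powers H k : gain H k \in (powers s : seq R).
Proof. exact: fsvalP. Qed.

Lemma min_powers_mem : seq_min (powers s) \in (powers s : seq R).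
Proof. exact/seq_min_mem/powers_neq0. Qed.

Lemma min_powers_gt0 : 0 < seq_min (powers s).
Proof. exact/powers_gt0/min_powers_mem. Qed.

Lemma gain_min_eq X H (i : 'I_(ngroups X)) :
  exists2 k, k \in group_users i & gain_min H i = gain H k.
Proof.
have : gain_min H i \in [seq gain H k | k in group_users i].
  by apply: seq_min_mem; rewrite size_image card_gt0 group_users_neq0.
by move=> /mapP[k]; rewrite mem_enum => ki ?; exists k.
Qed.

Lemma min_powers_le X H (i : 'I_(ngroups X)) :
  seq_min (powers s) <= gain_min H i.
Proof. by have [k _ ->] := gain_min_eq H i; exact/seq_min_le/gain_powers. Qed.

Lemma gain_min_gt0 X H (i : 'I_(ngroups X)) : 0 < gain_min H i.
Proof. exact: lt_le_trans min_powers_gt0 (min_powers_le H i). Qed.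

Lemma gain_min_le X H (i : 'I_(ngroups X)) k :
  k \in group_users i -> gain_min H i <= gain H k.
Proof. by move=> ki; apply/seq_min_le/map_f; rewrite mem_enum. Qed.

Lemma ntiles_gt0 X (i : 'I_(ngroups X)) : 0 < (ntiles i)%:R :> R.
Proof. by rewrite ltr0n card_gt0 group_tiles_neq0. Qed.

(** Some user exists and needs a tile, which must lie in some group. *)
Lemma ngroups_gt0 X : (0 < ngroups X)%N.
Proof.
have /set0Pn[x xk] := needed_neq0 X (Ordinal (nusers_gt0 s)).
have : x \in (\bigcup_k needed X k)%SET.
  by apply/bigcupP; exists (Ordinal (nusers_gt0 s)).
by rewrite -group_tiles_cover => /bigcupP[i _ _]; exact: leq_trans (ltn_ord i).
Qed.

Definition total_tiles X := (\sum_i ntiles (X := X) i)%N.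

Lemma total_tiles_gt0 X : (0 < total_tiles X)%N.
Proof.
rewrite /total_tiles (bigD1 (Ordinal (ngroups_gt0 X)))//= addn_gt0.
by rewrite -(ltr0n R) ntiles_gt0.
Qed.

Lemma exists_max_tiles : exists X0, \max_X total_tiles X = total_tiles X0.
Proof.
have [|X0 eqX0] := @bigop.eq_bigmax _ total_tiles; last by exists X0.
apply/card_gt0P.
by exists [ffun=> (Ordinal (nhoriz_gt0 s), Ordinal (nvert_gt0 s))].
Qed.

Lemma ln2_gt0 : 0 < ln 2 :> R.
Proof. by rewrite ln_gt0 ?ltr1n. Qed.

Lemma group_load_gt0 X (i : 'I_(ngroups X)) (D : R) : 0 < D ->
  0 < (ntiles i)%:R * D * ln 2 / bandwidth s.
Proof.
move=> D_gt; rewrite divr_gt0 ?bandwidth_gt0// mulr_gt0 ?ln2_gt0//.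
by rewrite mulr_gt0 ?ntiles_gt0.
Qed.

(** * Feasibility and optimality of the proposed solution *)

Section Star.
Variables (E : R) (hE : 0 < E).

Local Notation D := (quality_star s E).
Local Notation h0 := (seq_min (powers s)).
Local Notation B := (bandwidth s).
Local Notation T := (duration s).
Local Notation n0 := (noise s).

(** The signal-to-noise ratio on the worst channel when the energy is spread evenly over the
    frame. *)
Let snr := E * h0 / (n0 * T).

Lemma snr_gt0 : 0 < snr.
Proof.
by rewrite divr_gt0 ?mulr_gt0 ?min_powers_gt0 ?noise_gt0 ?duration_gt0.
Qed.

Lemma quality_starE (X0 : views s) : \max_X total_tiles X = total_tiles X0 ->
  D * ln 2 * (total_tiles X0)%:R = B * ln (1 + snr).
Proof.
rewrite /quality_star -/snr => <-; rewrite [snr + 1]addrC.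
rewrite -mulrA divfK// mulf_neq0 ?gt_eqF ?ln2_gt0//.
by have [X1 ->] := exists_max_tiles; rewrite ltr0n total_tiles_gt0.
Qed.

Lemma quality_star_gt0 : 0 < D.
Proof.
have [X0 /quality_starE eqD] := exists_max_tiles.
have : 0 < D * ln 2 * (total_tiles X0)%:R.
  by rewrite eqD mulr_gt0 ?bandwidth_gt0// ln_gt0// ltrDl snr_gt0.
by rewrite -mulrA pmulr_lgt0// mulr_gt0 ?ln2_gt0// ltr0n total_tiles_gt0.
Qed.

Lemma lambert_termE (l : R) X H (i : 'I_(ngroups X)) :
  lambert_term l H i = rate (l * (gain_min H i / n0)).
Proof. by rewrite /lambert_term /rate invfM !mulrA. Qed.

(** Brings the equation to the form of [rate_multiplier_unique], with normalized gains
    [gain_min H i / n0]. *)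
Lemma is_multiplierE X H (l : R) : is_multiplier D X H l <->
  0 < l /\ \sum_(i < ngroups X)
    ((ntiles i)%:R * D * ln 2 / B) / rate (l * (gain_min H i / n0)) = 1.
Proof.
rewrite /is_multiplier; under eq_bigr do rewrite lambert_termE invfM !mulrA.
by under [in X in _ <-> X]eq_bigr do rewrite !mulrA.
Qed.

Lemma multiplier_unique X H : exists! l, is_multiplier D X H l.
Proof.
have [||l [lP l_uniq]] := @rate_multiplier_unique R _
    (fun i : 'I_(ngroups X) => (ntiles i)%:R * D * ln 2 / B)
    (fun i => gain_min H i / n0) _ _
    (Ordinal (ngroups_gt0 X)).
- by move=> i; rewrite group_load_gt0 ?quality_star_gt0.
- by move=> i; rewrite divr_gt0 ?gain_min_gt0 ?noise_gt0.
by exists l; split=> [|m /is_multiplierE/l_uniq//]; apply/is_multiplierE.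
Qed.

(* The bound comes from the state with the most tiles and the worst channel,
   where spending the energy uniformly over the frame is best. *)
Lemma quality_le D' (t p : group_family s) : feasible E D' t p -> D' <= D.
Proof.
move=> feas; have [X0 maxX0] := exists_max_tiles.
pose H0 : channels s := [ffun=> [` min_powers_mem]%fset].
have [p_ge t_ge sum_t rate_ge energy_le] := feas X0 H0.
have snr0 := snr_gt0; have T_gt := duration_gt0 s; have B_gt := bandwidth_gt0 s.
have n0_gt := noise_gt0 s; have h_gt := min_powers_gt0.
pose y i := p X0 H0 i * h0 / n0.
have y_ge i : 0 <= y i by rewrite divr_ge0 ?mulr_ge0 ?(ltW n0_gt) ?(ltW h_gt).
have energy : \sum_i t X0 H0 i * y i <= T * snr.
  under eq_bigr do rewrite /y !mulrA.
  rewrite -!mulr_suml.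
  have -> : T * snr = E * h0 / n0 by rewrite /snr; field; rewrite !gt_eqF.
  by rewrite !ler_pM2r ?invr_gt0.
(* In [H0] all users have gain [h0], so the constraint of any one member of the group gives the
   bound, here in nats. *)
have group_le i : (ntiles i)%:R * (D' * T * ln 2 / B) <=
    t X0 H0 i * ln (1 + y i).
  have /set0Pn[k ki] := group_users_neq0 i.
  have := rate_ge i k ki; rewrite /log2 /gain ffunE/= -/(y i) => le1.
  rewrite !mulrA ler_pdivrMr// -ler_pdivlMr ?ln2_gt0//.
  by apply: le_trans le1 _; rewrite le_eqVlt; apply/orP; left; apply/eqP; ring.
have le_total : (total_tiles X0)%:R * (D' * T * ln 2 / B) <= T * ln (1 + snr).
  rewrite natr_sum mulr_suml.
  apply: le_trans (ler_sum _ (fun i _ => group_le i)) _.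
  exact: sum_ln1D_le.
have S_gt : 0 < (total_tiles X0)%:R :> R by rewrite ltr0n total_tiles_gt0.
have := quality_starE maxX0 => eqD.
(* By [quality_starE], this factor turns the right side into [T * ln (1 + snr)]. *)
suff : D' * (ln 2 * (total_tiles X0)%:R * T / B) <=
    D * (ln 2 * (total_tiles X0)%:R * T / B).
  by rewrite ler_pM2r// divr_gt0 ?mulr_gt0 ?ln2_gt0.
rewrite !mulrA eqD.
apply: le_trans (_ : _ <= T * ln (1 + snr)) _.
  apply: le_trans le_total.
  by rewrite le_eqVlt; apply/orP; left; apply/eqP; ring.
by rewrite le_eqVlt; apply/orP; left; apply/eqP; field; rewrite gt_eqF.
Qed.

(** The times fill the frame exactly and the rate constraint is tight at gain [gain_min]; only the
    energy bound needs a comparison argument. *)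
Lemma star_feasible (lam : views s -> channels s -> R) :
  (forall X H, is_multiplier D X H (lam X H)) ->
  feasible E D (time_star D lam) (power_star lam).
Proof.
move=> lamP X H; have /is_multiplierE[l_gt sum_l] := lamP X H.
have D_gt := quality_star_gt0; have T_gt := duration_gt0 s.
have B_gt := bandwidth_gt0 s; have n0_gt := noise_gt0 s.
have ln2 := ln2_gt0.
pose g i := gain_min (X := X) H i / n0.
pose u i := rate (lam X H * g i).
have g_gt i : 0 < g i by rewrite divr_gt0 ?gain_min_gt0.
have u_gt i : 0 < u i by apply: rate_gt0; exact: mulr_gt0.
pose c i := (ntiles (X := X) i)%:R * D * ln 2 / B.
have c_gt i : 0 < c i by rewrite group_load_gt0.
have tE i : time_star D lam H i = c i * T / u i.
  rewrite /time_star lambert_termE -/(g i) -/(u i) /c; field.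
  by rewrite !gt_eqF.
have pE i : power_star lam H i = (expR (u i) - 1) / g i.
  rewrite /power_star lambert_termE -/(g i) -/(u i) /g; field.
  by rewrite !gt_eqF ?gain_min_gt0.
have p_ge (i : 'I_(ngroups X)) : 0 <= power_star lam H i.
  rewrite pE divr_ge0 ?(ltW (g_gt i))// subr_ge0 -expR0 ler_expR.
  exact/ltW/u_gt.
have t_ge (i : 'I_(ngroups X)) : 0 <= time_star D lam H i.
  by rewrite tE; apply: divr_ge0; [apply: mulr_ge0|]; exact: ltW.
have sum_t : \sum_(i < ngroups X) time_star D lam H i = T.
  under eq_bigr do rewrite tE mulrAC mulrC.
  by rewrite -mulr_sumr sum_l mulr1.
split=> //.
- by rewrite sum_t.
- move=> i k ki; rewrite /log2.
  apply: (@le_trans _ _ (time_star D lam H i * B * (u i / ln 2))).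
    rewrite tE /c le_eqVlt; apply/orP; left; apply/eqP; field.
    by rewrite !gt_eqF.
  apply: ler_wpM2l; first by apply: mulr_ge0 => //; exact: ltW.
  rewrite ler_pM2r ?invr_gt0//.
  have uE : expR (u i) = 1 + power_star lam H i * gain_min H i / n0.
    rewrite pE -mulrA -/(g i) divfK ?gt_eqF//; ring.
  rewrite -[leLHS]expRK uE ler_ln ?posrE.
  + by rewrite lerD2l !ler_wpM2r ?ler_wpM2l ?gain_min_le// invr_ge0 ltW.
  + by rewrite -uE expR_gt0.
  + apply: ltr_pwDl => //; apply: divr_ge0; last exact: ltW.
    by apply: mulr_ge0 => //; exact/ltW/powers_gt0/gain_powers.
(* [time_star] minimizes the energy among the allocations of total duration
   [T], in particular compared with giving all groups the same rate [v]. *)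
pose v := \sum_i c i; pose t' i := c i * T / v.
have v_gt : 0 < v.
  rewrite /v (bigD1 (Ordinal (ngroups_gt0 X)))//= ltr_pwDl// sumr_ge0// => i _.
  exact/ltW.
have t'_ge i : 0 <= t' i.
  by apply: divr_ge0; [apply: mulr_ge0|]; exact: ltW.
have sum_t' : \sum_i t' i = T.
  by rewrite /t' -mulr_suml -mulr_suml -/v mulrAC divff ?mul1r// gt_eqF.
(* After division by [g i], the slope from [rateE] becomes the same [lam X H] for all groups; the
   corrections then cancel in the sum, both allocations having total duration [T]. *)
have energy_le i : time_star D lam H i * power_star lam H i
    <= t' i * (expR v - 1) / g i + lam X H * (t' i - time_star D lam H i).
  have := @energy_tangent R (time_star D lam H i) (u i) (t' i) v (t'_ge i).
  have -> : time_star D lam H i * u i = t' i * v.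
    by rewrite tE /t' !divfK ?gt_eqF.
  move=> /(_ erefl); rewrite rateE; last by apply: mulr_ge0; exact: ltW.
  rewrite pE mulrA -lerBlDr ler_pdivlMr// mulrBl divfK ?gt_eqF// => le1.
  by apply: le_trans le1; rewrite lerD2l lerN2 mulrAC.
apply: le_trans (ler_sum _ (fun i _ => energy_le i)) _.
rewrite big_split/= -mulr_sumr sumrB sum_t sum_t' subrr mulr0 addr0.
(* [B * v] is [D * ln 2] times the number of tiles in [X], and the largest such number yields
   [B * ln (1 + snr)]. *)
have v_le : expR v - 1 <= snr.
  rewrite lerBlDl -[leRHS]lnK ?posrE; last by rewrite addr_gt0 ?snr_gt0.
  have [X0 maxX0] := exists_max_tiles.
  rewrite ler_expR -(ler_pM2l B_gt) -(quality_starE maxX0).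
  have -> : B * v = D * ln 2 * (total_tiles X)%:R.
    rewrite /v /c -!mulr_suml -natr_sum -/(total_tiles X); field.
    by rewrite gt_eqF.
  apply: ler_wpM2l; first by apply: mulr_ge0; exact: ltW.
  by rewrite ler_nat -maxX0 (bigop.leq_bigmax X).
have h_gt := min_powers_gt0.
(* Each gain is replaced by the worst one, after which the energy sums to exactly [E]. *)
apply: (@le_trans _ _ (\sum_i t' i * (snr * n0 / h0))).
  apply: ler_sum => i _; rewrite -mulrA ler_wpM2l//.
  rewrite /g invf_div mulrA; apply: ler_pM.
  - by rewrite mulr_ge0 ?(ltW n0_gt)// subr_ge0 -expR0 ler_expR ltW.
  - by rewrite invr_ge0 ltW ?gain_min_gt0.
  - by rewrite ler_pM2r.
  - by rewrite lef_pV2 ?posrE ?gain_min_gt0// min_powers_le.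
rewrite -mulr_suml sum_t' /snr le_eqVlt; apply/orP; left; apply/eqP; field.
by rewrite !gt_eqF.
Qed.

End Star.
End System.

Theorem lemma5 (R : realType) (s : system R) (E : R) (hE : 0 < E) :
  (forall (X : views s) (H : channels s),
     exists! l : R, is_multiplier (quality_star s E) X H l) /\
  (forall lam : views s -> channels s -> R,
     (forall X H, is_multiplier (quality_star s E) X H (lam X H)) ->
     optimal E (quality_star s E)
       (time_star (quality_star s E) lam) (power_star lam)).
Proof.
split=> [X H|lam lamP]; first exact: multiplier_unique.
split=> [|D' t' p']; [exact: star_feasible|exact: quality_le].
Qed.
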